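(* Let $0<\delta<1$. For every linear function $u^{\rm lin}(x)=Fx+a$ with $F,a\in\mathbb{R}$, $$\mathcal{L}^{\rm qnl}_\delta u^{\rm lin}(x)=0\qquad\text{for all }x\in\Omega=(-1,1).$$
   Context: The kernel is $\gamma_\delta(s)=\gamma_\delta(|s|)=\delta^{-3}\gamma(|s|/\delta)$ for $s\in\mathbb{R}$, where $\gamma\ge 0$ is nonincreasing on $(0,1)$, is supported in $[0,1]$ (i.e. $\gamma(r)=0$ for $r>1$), and satisfies $\int_{\mathbb{R}}|s|^2\gamma(|s|)\,ds=1$. The weight is $\omega_\delta(x)=\int_0^1 dt\int_{|s|<x/t}|s|^2\gamma_\delta(|s|)\,ds$ for $x>0$ (so $\omega_\delta(x)=1$ for $x\ge\delta$). The quasinonlocal (QNL) operator is defined by $$\mathcal{L}^{\rm qnl}_\delta u(x)=\begin{cases}2\int_{\mathbb{R}}\gamma_\delta(|y-x|)(u(y)-u(x))\,dy, & x\le 0,\\ 2\int_{y<0}\gamma_\delta(|y-x|)(u(y)-u(x))\,dy+(\omega_\delta u')'(x), & 0<x\le\delta,\\ u''(x), & x>\delta,\end{cases}$$ where the integral for $x\le 0$ is taken in the principal value sense if it is not absolutely convergent. *)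

(* Defs.v *)
From HB Require Import structures.
From mathcomp Require Import all_boot all_order all_algebra.
From mathcomp Require Import all_classical all_reals all_analysis.
Set Implicit Arguments.
Unset Strict Implicit.
Unset Printing Implicit Defensive.
Import Order.TTheory GRing.Theory Num.Theory.
Import numFieldNormedType.Exports.
Local Open Scope classical_set_scope.
Local Open Scope ring_scope.

(* [gamma] is only constrained at positive arguments: kernels that are singular
   at the origin are allowed, and the value at 0 plays no role. *)
Record qnl_kernel (R : realType) (gamma : R -> R) : Prop := QnlKernel {
  qnl_kernel_ge0 : forall r : R, 0 < r -> 0 <= gamma r ;
  qnl_kernel_nonincr : forall r s : R, 0 < r -> r <= s -> s < 1 -> gamma s <= gamma r ;
  qnl_kernel_supp : forall r : R, 1 < r -> gamma r = 0 ;
  qnl_kernel_moment2 :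
    (\int[@lebesgue_measure R]_s (`|s| ^+ 2 * gamma `|s|)%:E = 1)%E }.

Definition scaled_kernel (R : realType) (gamma : R -> R) (delta s : R) : R :=
  delta ^- 3 * gamma (`|s| / delta).

Definition qnl_weight (R : realType) (gamma : R -> R) (delta x : R) : R :=
  fine (\int[@lebesgue_measure R]_(t in `]0%R, 1%R[)
          \int[@lebesgue_measure R]_(s in [set s | (`|s| < x / t)%R])
            (`|s| ^+ 2 * scaled_kernel gamma delta `|s|)%:E)%E.

Definition abs_convergent (R : realType) (D : set R) (g : R -> R) : Prop :=
  (@lebesgue_measure R).-integrable D (EFin \o g).

Definition truncated_integral (R : realType) (g : R -> R) (x e : R) : R :=
  \int[@lebesgue_measure R]_(y in [set y | e < `|y - x|]) g y.

Definition pv_integral (R : realType) (g : R -> R) (x : R) : R :=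
  if `[< abs_convergent setT g >] then \int[@lebesgue_measure R]_y g y
  else lim (truncated_integral g x e @[e --> 0^'+]).

(* [lim] and the integral are total with default values, so the
   existence of the principal value is a separate predicate. *)
Definition pv_exists (R : realType) (g : R -> R) (x : R) : Prop :=
  abs_convergent setT g \/
  ((forall e : R, 0 < e -> abs_convergent [set y | e < `|y - x|] g) /\
   cvg (truncated_integral g x e @[e --> 0^'+])).

Definition nonlocal_integrand (R : realType) (gamma : R -> R) (delta : R)
    (u : R -> R) (x y : R) : R :=
  scaled_kernel gamma delta `|y - x| * (u y - u x).

Definition qnl_op (R : realType) (gamma : R -> R) (delta : R)
    (u : R -> R) (x : R) : R :=
  if x <= 0 then 2 * pv_integral (nonlocal_integrand gamma delta u x) x
  else if x <= delta then
    2 * (\int[@lebesgue_measure R]_(y in [set y | y < 0])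
            nonlocal_integrand gamma delta u x y)
    + derive1 (fun z => qnl_weight gamma delta z * derive1 u z) x
  else derive1 (derive1 u) x.

(* All the integrals and derivatives in the branch of [qnl_op] that is active
   at [x] exist, so that [qnl_op gamma delta u x] is not a default value. *)
Definition qnl_op_defined (R : realType) (gamma : R -> R) (delta : R)
    (u : R -> R) (x : R) : Prop :=
  if x <= 0 then pv_exists (nonlocal_integrand gamma delta u x) x
  else if x <= delta then
    [/\ abs_convergent [set y | y < 0] (nonlocal_integrand gamma delta u x),
        \forall z \near x, derivable u z 1 &
        derivable (fun z => qnl_weight gamma delta z * derive1 u z) x 1]
  else (\forall z \near x, derivable u z 1) /\ derivable (derive1 u) x 1.

(* Main.v *)
Require Import Defs.
From HB Require Import structures.
From mathcomp Require Import all_boot all_order all_algebra.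
From mathcomp Require Import all_classical all_reals all_analysis.
From mathcomp Require Import measurable_realfun.
From mathcomp Require Import ring lra.
Import Order.TTheory GRing.Theory Num.Theory.
Import numFieldNormedType.Exports.
Local Open Scope classical_set_scope.
Local Open Scope ring_scope.

(** Write kappa(s) = |s| gamma_delta(|s|), an even nonnegative density, and
    u(z) = F z + a. The nonlocal integrand at x is F kappa(y - x) for y > x and
    - F kappa(y - x) for y < x.

    For x <= 0 the integrand is odd under the reflection of the line about x,
    so its integral over every region symmetric about x vanishes, in particular
    over each truncation |y - x| > e
    ([truncated_linear_integral], [pv_linear_integral]).

    For 0 < x <= delta only y < 0 is kept, and the surviving force
    - 2F times the integral of kappa over s < -x has to be balanced by
    F omega_delta'(x). Exchanging the two integrals in omega_delta gives
      omega_delta(x) = integral of kappa(s) min(|s|, x) ds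
    ([qnl_weightE]). The integrand has derivative kappa(s) in x where |s| > x
    and 0 where |s| < x, so by dominated convergence omega_delta'(x) is the
    integral of kappa over |s| > x ([is_derive_qnl_weight]), which by evenness
    is twice its integral over s < -x: the two terms cancel exactly
    ([Rintegral_linear_integrand_left]). The derivative exists at every x > 0,
    including jumps of gamma and the interface x = delta, because the kinks
    |s| = x form a null set.

    For x > delta the operator is u'' = 0.

    The second moment bound makes |s| kappa(s) integrable, so kappa is
    integrable away from the origin even when gamma is singular there; the
    assumption is transported from gamma to gamma_delta by the affine change of
    variables, and gamma is measurable because it is monotone on (0, 1). *)

(** * Affine changes of variables for the Lebesgue measure *)

Lemma measurable_affine (R : realType) (c b : R) :
  measurable_fun [set: R] (fun y => c * y + b).
Proof. by apply: measurable_funD => //; exact: measurable_funM. Qed.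

(** A measure on the line is determined by its values on half-open intervals,
    and there the identity is an explicit length computation; a negative slope
    exchanges the open and the closed end. *)
Lemma lebesgue_measure_affine (R : realType) (c b : R) (A : set R) :
  c != 0 -> measurable A ->
  lebesgue_measure A =
    (`|c|%:E * lebesgue_measure ((fun y => (c * y + b)%R) @^-1` A))%E.
Proof.
move=> c0 mA; pose phi : measurableTypeR R -> measurableTypeR R := fun y => c * y + b.
have mphi : measurable_fun [set: measurableTypeR R] phi by exact: measurable_affine.
(* The measure structure of a pushforward takes the measurability proof as an
   argument, which unification cannot supply. *)
pose pushed : {measure set (measurableTypeR R) -> \bar R} :=
  measure_function_pushforward__canonical__measure_function_Measure
    lebesgue_measure mphi.
have k0 : 0 <= `|c| by [].
pose nu : {measure set (measurableTypeR R) -> \bar R} :=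
  mscale (NngNum k0) pushed.
rewrite (@lebesgue_measure_unique R nu)// => _ [[l r] _ <-]/=.
rewrite /nu /mscale/= /pushed/= /pushforward.
rewrite lebesgue_measure_itv/= lte_fin.
have [cgt0|cle0] := ltP 0 c.
  rewrite (_ : _ @^-1` _ = [set` `](l - b) / c, (r - b) / c]]); last first.
    by apply/seteqP; split => y /=; rewrite !in_itv/= /phi ltr_pdivrMr// ler_pdivlMr//
      ltrBlDr lerBrDr (mulrC y)//.
  rewrite lebesgue_measure_itv/= lte_fin ltr_pM2r ?invr_gt0// ltrD2r gtr0_norm//.
  case: ifPn => _; last by rewrite mule0.
  by rewrite -!EFinB -EFinM; congr EFin; field.
have clt0 : c < 0 by rewrite lt_neqAle c0.
rewrite (_ : _ @^-1` _ = [set` `[(r - b) / c, (l - b) / c[]); last first.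
  by apply/seteqP; split => y /=;
    rewrite !in_itv/= /phi ler_ndivrMr// ltr_ndivlMr// ltrBlDr lerBrDr
      (mulrC y) andbC.
rewrite lebesgue_measure_itv/= lte_fin ltr_nM2r ?invr_lt0// ltrD2r ltr0_norm//.
case: ifPn => _; last by rewrite mule0.
by rewrite -!EFinB -EFinM; congr EFin; field.
Qed.

Lemma ge0_integral_affine (R : realType) (c b : R) (D : set R) (f : R -> \bar R) :
  c != 0 -> measurable D -> measurable_fun D f -> (forall s, D s -> 0 <= f s)%E ->
  (\int[lebesgue_measure]_(s in D) f s =
   `|c|%:E * \int[lebesgue_measure]_(y in [set y | D (c * y + b)%R])
               f (c * y + b)%R)%E.
Proof.
move=> c0 mD mf f0.
pose phi : measurableTypeR R -> measurableTypeR R := fun y => c * y + b.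
have mphi : measurable_fun [set: measurableTypeR R] phi by exact: measurable_affine.
pose pushed : {measure set (measurableTypeR R) -> \bar R} :=
  measure_function_pushforward__canonical__measure_function_Measure
    lebesgue_measure mphi.
have k0 : 0 <= `|c| by [].
rewrite (@eq_measure_integral _ _ _ _
  (mscale (NngNum k0) pushed)); last first.
  by move=> A mA _ /=; rewrite (@lebesgue_measure_affine _ c b).
rewrite ge0_integral_mscale//= ge0_integral_pushforward//.
by move=> s /set_mem; exact: f0.
Qed.

(** The map enters as [phi] together with its affine form, so that translations
    and reflections can be used in whichever shape they occur. For slope 1 or -1
    no factor appears, and the positive and negative parts can be transported
    separately without integrability. *)
Lemma integral_isometry (R : realType) (c b : R) (phi : R -> R) (D : set R)
    (f : R -> \bar R) :
  (forall y, phi y = c * y + b) -> `|c| = 1 -> measurable D -> measurable_fun D f ->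
  (\int[lebesgue_measure]_(s in D) f s =
   \int[lebesgue_measure]_(y in phi @^-1` D) f (phi y))%E.
Proof.
move=> /funext -> c1 mD mf; have c0 : c != 0 by rewrite -normr_gt0 c1.
have ge0 g : measurable_fun D g -> (forall s, D s -> 0 <= g s)%E ->
    (\int[lebesgue_measure]_(s in D) g s =
     \int[lebesgue_measure]_(y in [set y | D (c * y + b)%R]) g (c * y + b)%R)%E.
  by move=> mg g0; rewrite (@ge0_integral_affine _ c b)// c1 mul1e.
rewrite [LHS]integralE [RHS]integralE.
rewrite ge0//; last exact: measurable_funepos.
rewrite (ge0 f^\-%E)//; last exact: measurable_funeneg.
by rewrite !unlock.
Qed.

Lemma integrable_affine (R : realType) (c b : R) (phi : R -> R) (D : set R)
    (f : R -> R) :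
  (forall y, phi y = c * y + b) -> c != 0 -> measurable D ->
  lebesgue_measure.-integrable D (EFin \o f) ->
  lebesgue_measure.-integrable (phi @^-1` D) (EFin \o (f \o phi)).
Proof.
move=> /funext -> c0 mD /integrableP[mf fD].
have mphi := @measurable_affine R c b.
have mD' : measurable [set y | D (c * y + b)%R].
  by rewrite -[X in measurable X]setTI; exact: mphi.
apply/integrableP; split.
  apply: (@measurable_comp _ _ _ _ _ _ D (EFin \o f) _
    (fun y => c * y + b)) => //; first by move=> _ [y Dy <-].
  exact: measurable_funTS.
move: fD; rewrite (@ge0_integral_affine _ c b)//; last exact: measurableT_comp.
apply: contraTT; rewrite -!leNgt !leye_eq => /eqP ->.
by rewrite gt0_muley// lte_fin normr_gt0.
Qed.

(** * Symmetry and monotonicity *)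

Lemma measurable_norm_gt (R : realType) (x e : R) :
  measurable [set y : R | e < `|y - x|].
Proof.
have m : measurable_fun [set: R] (fun y : R => `|y - x|).
  by apply: measurableT_comp => //; exact: measurable_funB.
rewrite [X in measurable X](_ : _ = setT `&` (fun y => `|y - x|) @^-1` `]e, +oo[).
  by apply: m => //; exact: measurable_itv.
by rewrite setTI; apply/seteqP; split => y /=; rewrite in_itv/= andbT.
Qed.

Lemma measurable_norm_gt0 (R : realType) (e : R) :
  measurable [set s : R | e < `|s|].
Proof.
by have := measurable_norm_gt _ 0 e; under eq_set do rewrite subr0.
Qed.

Lemma measurable_lt (R : realType) (e : R) : measurable [set s : R | s < e].
Proof. by have := @measurable_itv R `]-oo, e[; rewrite set_itvNyo. Qed.

Lemma Rintegral_even_norm_gt (R : realType) (k : R -> R) (e : R) : 0 <= e ->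
  measurable_fun [set: R] k -> (forall s, k (- s) = k s) ->
  lebesgue_measure.-integrable [set s | e < `|s|] (EFin \o k) ->
  \int[lebesgue_measure]_(s in [set s | e < `|s|]) k s =
  2 * \int[lebesgue_measure]_(s in [set s | s < - e]) k s.
Proof.
move=> e0 mk k_even ik.
have mL := measurable_lt R (- e).
have mR : measurable [set s : R | e < s].
  by have := @measurable_itv R `]e, +oo[; rewrite set_itvoy.
have D_E : [set s : R | e < `|s|] = [set s | s < - e] `|` [set s | e < s].
  apply/seteqP; split => s /=; rewrite ltr_normr ltrNr.
    by move=> /orP[]; [right|left].
  by move=> [->|->]; rewrite ?orbT.
move: ik; rewrite D_E => ik; rewrite Rintegral_setU//; last first.
  by apply/disj_set2P/seteqP; split => // s [/=]; lra.
rewrite mulrDl mul1r; congr (_ + _).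
rewrite /Rintegral (integral_isometry _ (-1) 0 -%R)//; last 3 first.
- by move=> y; rewrite mulN1r addr0.
- by rewrite normrN1.
- by apply/measurable_EFinP; exact: measurable_funTS.
rewrite (_ : _ @^-1` _ = [set s | s < - e]); last first.
  by apply/seteqP; split => s /=; lra.
by congr fine; apply: eq_integral => s _; rewrite k_even.
Qed.

(** Reflecting the domain about x turns the integral into its own opposite. *)
Lemma Rintegral_odd_about (R : realType) (x : R) (D : set R) (g : R -> R) :
  measurable D -> (forall y, D (2 * x - y) <-> D y) ->
  (forall y, g (2 * x - y) = - g y) ->
  lebesgue_measure.-integrable D (EFin \o g) ->
  \int[lebesgue_measure]_(y in D) g y = 0.
Proof.
move=> mD Dsym g_odd ig.
suff : \int[lebesgue_measure]_(y in D) g y = - \int[lebesgue_measure]_(y in D) g y by lra.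
rewrite -mulN1r -RintegralZl//.
rewrite {1}/Rintegral (integral_isometry _ (-1) (2 * x) (fun y => 2 * x - y))//;
  last 3 first.
- by move=> y; ring.
- by rewrite normrN1.
- exact: measurable_int ig.
rewrite (_ : _ @^-1` _ = D); last first.
  by apply/seteqP; split => y /=; rewrite Dsym.
by congr fine; apply: eq_integral => y _; rewrite g_odd mulN1r.
Qed.

(** The part of D where f is at least r is again an interval. *)
Lemma nonincreasing_in_measurable (R : realType) (D : set R) (f : R -> R) :
  is_interval D ->
  (forall r s, D r -> D s -> r <= s -> f s <= f r) ->
  measurable_fun D f.
Proof.
move=> iD f_ni mD; apply: (measurability _ (RGenCInfty.measurableE R)) => //.
move=> /= _ [_ [r ->] <-].
apply: is_interval_measurable => s t [Ds /=].
rewrite !in_itv/= !andbT => rs [Dt rt] u /andP[su ut].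
have Du : D u by apply: (iD s t) => //; rewrite su ut.
by split => //; rewrite in_itv/= andbT (le_trans rt)// f_ni.
Qed.

(** * Differentiating a truncated moment *)

(** As a function of z, min(r, |z|) has slope at most 1 wherever it varies, but
    the bound by |z - x| alone would not be integrable against a density that is
    singular at the origin. The factor r / x comes from concavity: on [0, x] the
    graph of min(r, .) lies above its chord, of slope min(r, x) / x. Using |z| instead of
    z makes the bound valid for all z, so that difference quotients are dominated
    along arbitrary sequences tending to x. *)
Lemma le_norm_minB (R : realType) (x r z : R) : 0 < x -> 0 <= r ->
  `|Num.min r `|z| - Num.min r x| <= `|z - x| * (r / x).
Proof.
move=> x0 r0.
have zx : `| `|z| - x| <= `|z - x|.
  by rewrite -{1}(gtr0_norm x0); exact: ler_dist_dist.
apply: (@le_trans _ _ (`| `|z| - x| * (r / x))); last first.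
  by apply: ler_wpM2r => //; rewrite divr_ge0// ltW.
have z0 := normr_ge0 z; move: (`|z|) z0 => {zx}z z0.
rewrite mulrA ler_pdivlMr//.
have [rz|zr] := leP r z; have [rx|xr] := leP r x.
- by rewrite subrr normr0 mul0r mulr_ge0.
- rewrite !ger0_norm; [|lra..]; nra.
- rewrite !ler0_norm; [|lra..]; nra.
- by rewrite mulrC [leRHS]mulrC ler_wpM2r// ltW.
Qed.

(** The density k may be singular at the origin: only |s| k(s) is assumed to be
    integrable, which suffices because min(|s|, z) vanishes there like |s|. *)
Section truncated_moment.
Variables (R : realType) (k : R -> R).
Notation mu := (@lebesgue_measure R).
Hypothesis mk : measurable_fun [set: R] k.
Hypothesis ik : mu.-integrable setT (fun s => (`|s| * k s)%:E).

Lemma integrable_norm_gt (e : R) : 0 < e ->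
  mu.-integrable [set s | e < `|s|] (EFin \o k).
Proof.
move=> e0; have mD := measurable_norm_gt0 R e.
have ig : mu.-integrable [set s | e < `|s|]
    (fun s => (e^-1)%:E * (`|s| * k s)%:E)%E.
  by apply: integrableZl => //; exact: integrableS ik.
apply: le_integrable ig => //.
  by apply/measurable_EFinP; exact: measurable_funTS.
move=> s /= es; rewrite lee_fin !normrM normr_id mulrA ler_peMl//.
by rewrite gtr0_norm ?invr_gt0// mulrC ler_pdivlMr// mul1r ltW.
Qed.

Lemma measurable_truncated_moment (z : R) :
  measurable_fun [set: R] (fun s => k s * Num.min `|s| z).
Proof.
by apply: measurable_funM => //; apply: measurable_minr => //.
Qed.

Lemma integrable_truncated_moment (z : R) : 0 <= z ->
  mu.-integrable setT (fun s => (k s * Num.min `|s| z)%:E).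
Proof.
move=> z0; apply: le_integrable ik => //.
  by apply/measurable_EFinP; exact: measurable_truncated_moment.
move=> s _; rewrite lee_fin !normrM normr_id mulrC ler_wpM2r//.
by rewrite ger0_norm ?ge_min ?lexx// le_min z0 normr_ge0.
Qed.

(** The integrand is not differentiable in z at the kinks |s| = x, so the limit of
    the difference quotients is only taken almost everywhere; off the kinks the
    quotients are eventually constant, equal to k s or to 0. *)
Lemma is_derive_truncated_moment (x : R) : 0 < x ->
  is_derive x 1 (fun z => \int[mu]_s (k s * Num.min `|s| `|z|))
    (\int[mu]_(s in [set s | x < `|s|]) k s).
Proof.
move=> x0.
have mD := measurable_norm_gt0 R x.
set W := fun z => \int[mu]_s (k s * Num.min `|s| `|z|).
suff cv : h^-1 *: (W (h *: 1 + x) - W x) @[h --> 0^'] -->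
    \int[mu]_(s in [set s | x < `|s|]) k s.
  apply: DeriveDef; first by apply/cvg_ex; eexists; exact: cv.
  exact: cvg_lim cv.
apply/cvgr_dnbhsP => u [u0 u_cvg].
pose m (z s : R) : R := k s * Num.min `|s| `|z|.
have im z : mu.-integrable setT (fun s => (m z s)%:E).
  exact: integrable_truncated_moment.
have imB z : mu.-integrable setT (fun s => (m z s - m x s)%:E).
  under eq_fun do rewrite EFinB.
  by apply: integrableB => //; exact: im.
pose q n (s : R) : R := (u n)^-1 * (m (u n + x) s - m x s).
have iq n : mu.-integrable setT (fun s => (q n s)%:E).
  rewrite /q; under eq_fun do rewrite EFinM.
  by apply: integrableZl => //; exact: imB.
rewrite [X in X @ _ --> _](_ : _ = fun n => fine (\int[mu]_s (q n s)%:E)%E);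
    last first.
  apply/funext => n; rewrite /W -[u n *: 1]/(u n * 1) mulr1.
  rewrite -RintegralB//; [|exact: im..].
  by rewrite -[LHS]RintegralZl//; exact: imB.
have iG : mu.-integrable setT (fun s => (x^-1)%:E * `|(`|s| * k s)%:E|)%E.
  by apply: integrableZl => //; exact: integrable_abse.
have q_le : {ae mu, forall s n, setT s ->
    (`|(q n s)%:E| <= (x^-1)%:E * `|(`|s| * k s)%:E|)%E}.
  apply: aeW => s n _; rewrite lee_fin /q /m -mulrBr !normrM normr_id.
  rewrite normfV ler_pdivrMl ?normr_gt0//.
  rewrite (gtr0_norm x0).
  have := le_norm_minB _ x `|s| (u n + x) x0 (normr_ge0 s).
  rewrite addrK => h.
  apply: (le_trans (ler_wpM2l (normr_ge0 _) h)).
  by rewrite le_eqVlt; apply/orP; left; apply/eqP; ring.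
have q_cvg : {ae mu, forall s, setT s ->
    (q n s)%:E @[n --> \oo] --> ((k \_ [set s | x < `|s|]) s)%:E}.
  exists [set x; - x]; split => /=.
  - by apply: measurableU; exact: measurable_set1.
  - exact/countable_lebesgue_measure0/finite_set_countable.
  move=> s; apply: contra_notP => sx _.
  have {}sx : `|s| != x.
    apply: contra_notN sx => /eqP <-.
    by have [s0|s0] := leP 0 s; [left; rewrite ger0_norm|right; rewrite ltr0_norm ?opprK].
  apply: cvg_EFin; first exact: nearW.
  (* An increment below this bound neither crosses the kink nor leaves z > 0. *)
  have d0 : 0 < Num.min `| `|s| - x| x by rewrite lt_min normr_gt0 subr_eq0 sx.
  have near_q : \forall n \near \oo, (k \_ [set s | x < `|s|]) s = q n s.
    move/cvgr0Pnorm_lt : u_cvg => /(_ _ d0); apply: filterS => n.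
    rewrite lt_min ltr_norml => /andP[+ unx]; rewrite /q /m -mulrBr mulrCA.
    have ux0 : 0 < u n + x by move: unx; rewrite ltr_norml => /andP[]; lra.
    rewrite (gtr0_norm ux0) (gtr0_norm x0) patchE.
    have [xs|sx'] := ltP x `|s|.
      rewrite mem_set//= gtr0_norm ?subr_gt0// => /andP[un1 un2].
      rewrite !min_r; [|lra..].
      by rewrite addrK mulVf// mulr1.
    have {sx'} xs : `|s| < x by rewrite lt_neqAle sx.
    rewrite memNset/=; last by apply/negP; rewrite -leNgt ltW.
    rewrite ltr0_norm ?subr_lt0// opprB => /andP[un1 un2].
    rewrite !min_l; [|lra..].
    by rewrite subrr !mulr0.
  by apply: cvg_trans (near_eq_cvg near_q) _; exact: cvg_cst.
have [] := dominated_convergence measurableT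
  (fun n => measurable_int _ (iq n)) _ q_cvg iG q_le.
  apply/measurable_EFinP/(measurable_restrictT _ _).1 => //.
  exact: measurable_funTS.
move=> ilim _ cvgq; rewrite Rintegral_mkcond; apply: fine_cvg.
by rewrite fineK//; exact: integrable_fin_num ilim.
Qed.
End truncated_moment.

(** * The scaled kernel and the weight *)

Section kernel.
Variables (R : realType) (gamma : R -> R) (delta : R).
Hypotheses (hgamma : qnl_kernel gamma) (delta0 : 0 < delta).
Notation mu := (@lebesgue_measure R).

(** Monotonicity is only known on (0, 1); the points 0 and 1 are split off as
    singletons, on which every function is measurable. *)
Lemma measurable_qnl_kernel : measurable_fun (`[0, +oo[%classic : set R) gamma.
Proof.
have -> : `[0, +oo[%classic = [set 0] `|` `]0, 1[ `|` [set 1] `|` `]1, +oo[ :> set R.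
  apply/seteqP; split => s /=; rewrite !in_itv/= !andbT; last first.
    by move=> [[[->//|]|->//]|]; lra.
  have [s1|s1|->] := ltgtP s 1; [|by right|by left; right].
  by rewrite le_eqVlt eq_sym => /orP[/eqP ->|s0]; left; left;
    [left|right; rewrite s0].
apply/measurable_funU => //; [by do ?apply: measurableU|split; last first].
  apply: (eq_measurable_fun (cst 0 : R -> R)) => // s.
  by rewrite inE/= in_itv/= andbT => s1; rewrite (qnl_kernel_supp hgamma).
apply/measurable_funU => //; [exact: measurableU|split; last exact: measurable_fun_set1].
apply/measurable_funU => //; split; first exact: measurable_fun_set1.
apply: nonincreasing_in_measurable; first exact: interval_is_interval.
move=> r s /=; rewrite !in_itv/= => /andP[r0 _] /andP[_ s1] rs.
exact: (qnl_kernel_nonincr hgamma).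
Qed.

Lemma measurable_scaled_kernel : measurable_fun setT (scaled_kernel gamma delta).
Proof.
apply: measurable_funM => //.
apply: (@measurable_comp _ _ _ _ _ _ (`[0, +oo[%classic : set R) gamma _
  (fun s : R => `|s| / delta)) => //.
- by move=> _ [s _ <-] /=; rewrite in_itv/= andbT divr_ge0// ltW.
- exact: measurable_qnl_kernel.
- by apply: measurable_funM => //; exact: normr_measurable.
Qed.

Lemma norm_scaled_kernel (s : R) :
  scaled_kernel gamma delta `|s| = scaled_kernel gamma delta s.
Proof. by rewrite /scaled_kernel normr_id. Qed.

Definition first_moment_density (s : R) : R := `|s| * scaled_kernel gamma delta s.
Notation kappa := first_moment_density.

Lemma first_moment_density_even s : kappa (- s) = kappa s.
Proof. by rewrite /kappa /scaled_kernel normrN. Qed.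

Lemma first_moment_density_ge0 s : 0 <= kappa s.
Proof.
have [->|s0] := eqVneq s 0; first by rewrite /kappa normr0 mul0r.
rewrite mulr_ge0// mulr_ge0//; first by rewrite invr_ge0 exprn_ge0// ltW.
by apply: (qnl_kernel_ge0 hgamma); rewrite divr_gt0// normr_gt0.
Qed.

Lemma measurable_first_moment_density : measurable_fun setT kappa.
Proof.
by apply: measurable_funM; [exact: normr_measurable|exact: measurable_scaled_kernel].
Qed.

(** The second-moment integrand of the scaled kernel at s is that of gamma at
    s / delta, divided by delta. *)
Lemma integrable_second_moment : mu.-integrable setT (fun s => (`|s| * kappa s)%:E).
Proof.
have : mu.-integrable setT (EFin \o (fun s : R => `|s| ^+ 2 * gamma `|s|)).
  apply/integrableP; split.
    apply/measurable_EFinP/measurable_funM.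
      by apply: measurable_funX; exact: normr_measurable.
    apply: (@measurable_comp _ _ _ _ _ _ (`[0, +oo[%classic : set R) gamma _
      (fun s : R => `|s|)) => //.
    + by move=> _ [s _ <-] /=; rewrite in_itv/= andbT.
    + exact: measurable_qnl_kernel.
  rewrite [ltLHS](_ : _ = 1%E) ?ltry//.
  rewrite -(qnl_kernel_moment2 hgamma).
  apply: eq_integral => s _ /=; rewrite ger0_norm//.
  have [->|s0] := eqVneq s 0; first by rewrite normr0 expr0n/= mul0r.
  by rewrite mulr_ge0// (qnl_kernel_ge0 hgamma)// normr_gt0.
have di0 : delta^-1 != 0 by rewrite invr_neq0// gt_eqF.
have scale_affine (s : R) : s / delta = delta^-1 * s + 0 by rewrite addr0 mulrC.
move/(integrable_affine _ _ _ _ _ _ scale_affine di0 measurableT).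
move/(integrableZl measurableT delta^-1); congr (_.-integrable _ _).
apply/funext => s; rewrite -EFinM; congr EFin.
rewrite /= normrM (@gtr0_norm _ delta^-1) ?invr_gt0// /kappa /scaled_kernel.
by field; rewrite gt_eqF.
Qed.

(** Tonelli: a given s contributes for those t in (0, 1) with t |s| < x, a set of
    length min(1, x / |s|), and |s| min(1, x / |s|) = min(|s|, x). *)
Lemma qnl_weightE (x : R) : 0 < x ->
  qnl_weight gamma delta x = \int[mu]_s (kappa s * Num.min `|s| x).
Proof.
move=> x0; congr fine.
pose f (p : R * R) : \bar R := (if [&& 0 < p.1, p.1 < 1 & `|p.2| * p.1 < x]
  then `|p.2| * kappa p.2 else 0)%:E.
have f0 p : (0 <= f p)%E.
  by rewrite lee_fin; case: ifPn => // _; rewrite mulr_ge0// first_moment_density_ge0.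
have mf : measurable_fun setT f.
  have m2 : measurable_fun setT (fun p : R * R => `|p.2|).
    by apply: measurableT_comp => //; exact: measurable_snd.
  apply/measurable_EFinP/measurable_fun_ifT => //.
    apply: measurable_and; first exact: measurable_fun_ltr.
    apply: measurable_and; first exact: measurable_fun_ltr.
    by apply: measurable_fun_ltr => //; exact: measurable_funM.
  apply: measurable_funM => //.
  by apply: measurableT_comp => //; exact: measurable_first_moment_density.
transitivity (\int[mu]_t \int[mu]_s f (t, s))%E.
  rewrite integral_mkcond; apply: eq_integral => t _; rewrite patchE.
  case: ifPn => [|t01].
    rewrite inE/= in_itv/= => /andP[t0 t1].
    rewrite integral_mkcond; apply: eq_integral => s _; rewrite patchE /f/= t0 t1/=.
    rewrite (_ : (s \in _) = (`|s| * t < x)); last first.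
      by apply/idP/idP; rewrite inE/= ltr_pdivlMr.
    by case: ifPn => // _; rewrite norm_scaled_kernel /kappa mulrA.
  rewrite integral0_eq// => s _; rewrite /f/= andbA ifF//.
  by move: t01; rewrite notin_setE/= in_itv/= => /negP/negbTE ->.
rewrite fubini_tonelli//; apply: eq_integral => s _.
have [->|s0] := eqVneq s 0.
  rewrite integral0_eq; first by rewrite /kappa normr0 !mul0r.
  by move=> t _; rewrite /f/= normr0 !mul0r; case: ifP.
have {}s0 : 0 < `|s| by rewrite normr_gt0.
pose c := Num.min 1 (x / `|s|).
have c0 : 0 < c by rewrite lt_min ltr01 divr_gt0.
transitivity (\int[mu]_(t in [set` `]0%R, c[]) (`|s| * kappa s)%:E)%E.
  rewrite [RHS]integral_mkcond; apply: eq_integral => t _; rewrite patchE /f/=.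
  rewrite (_ : (t \in _) = [&& 0 < t, t < 1 & `|s| * t < x]); last first.
    by apply/idP/idP; rewrite inE/= in_itv/= /c lt_min ltr_pdivlMr// (mulrC t).
  by case: ifP.
rewrite integral_cst//= lebesgue_measure_itv/= lte_fin c0 oppr0 adde0 -EFinM.
have -> : Num.min `|s| x = `|s| * c.
  by rewrite /c minr_pMr ?ltW// mulr1 mulrCA divff ?gt_eqF// mulr1.
by congr EFin; ring.
Qed.

(** The weight agrees near x with the truncated moment of kappa, in which |z|
    replaces z. *)
Lemma is_derive_qnl_weight (x : R) : 0 < x ->
  is_derive x 1 (qnl_weight gamma delta)
    (\int[mu]_(s in [set s | x < `|s|]) kappa s).
Proof.
move=> x0; apply: near_eq_is_derive (is_derive_truncated_moment _ _ _ _ _ x0).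
- near=> z; have z0 : 0 < z by near: z; exact: lt_nbhsr.
  by rewrite qnl_weightE// gtr0_norm.
- exact: measurable_first_moment_density.
- exact: integrable_second_moment.
Unshelve. all: by end_near. Qed.

End kernel.

(** * The operator on linear functions *)

Section qnl_linear.
Variables (R : realType) (gamma : R -> R) (delta : R).
Hypotheses (hgamma : qnl_kernel gamma) (delta0 : 0 < delta).
Notation mu := (@lebesgue_measure R).
Notation kappa := (first_moment_density R gamma delta).
Variables (F a : R).
Let u (z : R) : R := F * z + a.

Lemma linear_integrandE (x y : R) :
  nonlocal_integrand gamma delta u x y =
  F * (scaled_kernel gamma delta (y - x) * (y - x)).
Proof. by rewrite /nonlocal_integrand norm_scaled_kernel /u; ring. Qed.

Lemma measurable_linear_integrand (x : R) :
  measurable_fun [set: R] (nonlocal_integrand gamma delta u x).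
Proof.
rewrite (funext (linear_integrandE x)).
apply: measurable_funM => //; apply: measurable_funM; last exact: measurable_funB.
apply: measurableT_comp; last exact: measurable_funB.
exact: measurable_scaled_kernel.
Qed.

Lemma integrable_linear_integrand (x e : R) : 0 < e ->
  abs_convergent [set y | e < `|y - x|] (nonlocal_integrand gamma delta u x).
Proof.
move=> e0.
have ik : mu.-integrable [set s | e < `|s|] (EFin \o kappa).
  by apply: integrable_norm_gt => //;
    [exact: measurable_first_moment_density|exact: integrable_second_moment].
have mD := measurable_norm_gt0 R e.
have shift_affine (y : R) : y - x = 1 * y + - x by rewrite mul1r.
have ikx := integrable_affine _ _ _ _ _ _ shift_affine (oner_neq0 _) mD ik.
have mDx := measurable_norm_gt _ x e.
have : mu.-integrable [set y | e < `|y - x|] (fun y => F%:E * (kappa (y - x))%:E)%E.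
  exact: integrableZl.
apply: le_integrable => //.
  by apply/measurable_EFinP/measurable_funTS; exact: measurable_linear_integrand.
move=> y _; rewrite lee_fin linear_integrandE /first_moment_density.
by rewrite !normrM normr_id [X in _ <= _ * X]mulrC.
Qed.

Lemma linear_integrand_odd (x y : R) :
  nonlocal_integrand gamma delta u x (2 * x - y) =
  - nonlocal_integrand gamma delta u x y.
Proof.
rewrite !linear_integrandE /scaled_kernel (_ : 2 * x - y - x = - (y - x)); last by ring.
by rewrite normrN; ring.
Qed.

Lemma truncated_linear_integral (x e : R) : 0 < e ->
  truncated_integral (nonlocal_integrand gamma delta u x) x e = 0.
Proof.
move=> e0; apply: (Rintegral_odd_about _ x).
- exact: measurable_norm_gt.
- move=> y /=; rewrite (_ : 2 * x - y - x = - (y - x)); last by ring.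
  by rewrite normrN.
- exact: linear_integrand_odd.
- exact: integrable_linear_integrand.
Qed.

Lemma cvg_truncated_linear_integral (x : R) :
  truncated_integral (nonlocal_integrand gamma delta u x) x e @[e --> 0^'+] --> (0 : R).
Proof.
apply: cvg_trans (near_eq_cvg _) _; last exact: cvg_cst.
by near=> e; rewrite truncated_linear_integral.
Unshelve. all: by end_near. Qed.

Lemma pv_linear_integral (x : R) :
  pv_integral (nonlocal_integrand gamma delta u x) x = 0.
Proof.
rewrite /pv_integral; case: ifPn => [/asboolP ac|_]; last first.
  by apply/cvg_lim => //; exact: cvg_truncated_linear_integral.
apply: (Rintegral_odd_about _ x) => //.
exact: linear_integrand_odd.
Qed.

Lemma integrable_linear_integrand_left (x : R) : 0 < x ->
  abs_convergent [set y | y < 0] (nonlocal_integrand gamma delta u x).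
Proof.
move=> x0; apply: integrableS (integrable_linear_integrand x x x0).
- exact: measurable_norm_gt.
- exact: measurable_lt.
- by move=> y /= y0; rewrite ltr0_norm; lra.
Qed.

(** After translating by x the left half-line becomes s < -x, which carries half of
    the mass of kappa on |s| > x. *)
Lemma Rintegral_linear_integrand_left (x : R) : 0 < x ->
  2 * \int[mu]_(y in [set y | y < 0]) nonlocal_integrand gamma delta u x y =
  - F * \int[mu]_(s in [set s | x < `|s|]) kappa s.
Proof.
move=> x0.
have ik : mu.-integrable [set s | x < `|s|] (EFin \o kappa).
  by apply: integrable_norm_gt => //;
    [exact: measurable_first_moment_density|exact: integrable_second_moment].
rewrite Rintegral_even_norm_gt//; first last.
- exact: first_moment_density_even.
- exact: measurable_first_moment_density.
- exact: ltW.
have mL := measurable_lt R (- x).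
rewrite mulrCA; congr (2 * _); rewrite -RintegralZl//; last first.
  apply: integrableS ik => //.
    exact: measurable_norm_gt0.
  by move=> s /= sx; rewrite ltr0_norm; lra.
rewrite [RHS]/Rintegral (integral_isometry _ 1 (- x) (fun y => y - x))//;
  last 3 first.
- by move=> y; rewrite mul1r.
- by rewrite normr1.
- apply/measurable_EFinP/measurable_funM => //.
  by apply: measurable_funTS; exact: measurable_first_moment_density.
rewrite (_ : _ @^-1` _ = [set y : R | y < 0]); last first.
  by apply/seteqP; split => y /=; lra.
congr fine; apply: eq_integral => y; rewrite inE/= => y0; congr EFin.
rewrite linear_integrandE /first_moment_density ltr0_norm; last lra.
ring.
Qed.

Lemma is_derive_linear (z : R) : is_derive z 1 u F.
Proof.
have -> : u = F *: (id : R -> R) + cst a by [].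
by apply: is_derive_eq; rewrite addr0 -[LHS]/(F * 1) mulr1.
Qed.

Lemma derive1_linear : derive1 u = cst F.
Proof.
apply/funext => z; rewrite derive1E.
by have := is_derive_linear z => /@derive_val.
Qed.

End qnl_linear.

Theorem corollary2p1 (R : realType) (gamma : R -> R) (hgamma : qnl_kernel gamma)
    (delta : R) (hdelta0 : 0 < delta) (hdelta1 : delta < 1) (F a : R) :
  forall x : R, -1 < x -> x < 1 ->
    qnl_op_defined gamma delta (fun z => F * z + a) x /\
    qnl_op gamma delta (fun z => F * z + a) x = 0.
Proof.
move=> x _ _; rewrite /qnl_op_defined /qnl_op.
have du_near : \forall z \near x, derivable (fun z : R => F * z + a) z 1.
  by near=> z; have [] := is_derive_linear _ F a z.
case: ifPn => [x0|]; first split.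
- right; split; first by move=> e; exact: integrable_linear_integrand.
  by apply/cvg_ex; eexists; exact: cvg_truncated_linear_integral.
- by rewrite pv_linear_integral// mulr0.
rewrite -ltNge derive1_linear => x0; case: ifPn => _; last first.
  by split; [split; [exact: du_near|exact: derivable_cst]|rewrite derive1_cst].
have dw : is_derive x 1 (fun z => qnl_weight gamma delta z * cst F z)
    (F * \int[lebesgue_measure]_(s in [set s | x < `|s|])
           first_moment_density R gamma delta s).
  rewrite [X in is_derive _ _ X](_ : _ = F *: qnl_weight gamma delta); last first.
    by apply/funext => z /=; rewrite mulrC.
  apply: is_deriveZ; exact: is_derive_qnl_weight.
split.
  split; [exact: integrable_linear_integrand_left|exact: du_near|].
  by case: dw.
rewrite Rintegral_linear_integrand_left// derive1E.
have -> := @derive_val _ _ _ _ _ _ _ dw.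
by rewrite mulNr addNr.
Unshelve. all: by end_near. Qed.
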